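(* Let $\lambda,x\in\mathbb{R}$. Then the function $\nu\mapsto\widetilde{E}_\nu(\lambda,x)$ is log-convex on $(0,\infty)$, i.e. for all $\nu_1>0$, $\nu_2>0$ and all $\alpha\in[0,1]$, $$\widetilde{E}_{\alpha\nu_1+(1-\alpha)\nu_2}(\lambda,x)\le \left[\widetilde{E}_{\nu_1}(\lambda,x)\right]^{\alpha}\left[\widetilde{E}_{\nu_2}(\lambda,x)\right]^{1-\alpha}.$$ In particular, for all $\nu>0$, $$\left[\widetilde{E}_{\nu+1}(\lambda,x)\right]^2\le \widetilde{E}_\nu(\lambda,x)\,\widetilde{E}_{\nu+2}(\lambda,x).$$
   Context: For $\nu>0$ and $\lambda,x\in\mathbb{R}$, the Dunkl kernel is $$E_\nu(\lambda,x)=j_{\nu-\frac12}(i\lambda x)+\frac{\lambda x}{2\nu+1}\,j_{\nu+\frac12}(i\lambda x),$$ where $j_\alpha$ is the normalized Bessel function of the first kind of order $\alpha$, $$j_\alpha(z)=\Gamma(\alpha+1)\sum_{n=0}^\infty\frac{(-1)^n (z/2)^{2n}}{n!\,\Gamma(n+\alpha+1)}.$$ The normalized Dunkl kernel is $\widetilde{E}_\nu(\lambda,x)=\frac{1}{c(\nu)}E_\nu(\lambda,x)$, where $$c(\nu)=\frac{\Gamma(\nu+\frac12)}{\Gamma(\frac12)\,\Gamma(\nu)}.$$ *)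

(* Defs.v *)
From HB Require Import structures.
From mathcomp Require Import all_boot all_order all_algebra.
From mathcomp Require Import complex.
From mathcomp Require Import all_classical all_reals all_analysis.

Set Implicit Arguments.
Unset Strict Implicit.
Unset Printing Implicit Defensive.

Import Order.TTheory GRing.Theory Num.Theory.
Import numFieldNormedType.Exports.

Local Open Scope classical_set_scope.
Local Open Scope ring_scope.
Local Open Scope complex_scope.

(* Euler's Gamma function; meaningful for [0 < s], where the integral is
   finite. *)
Definition Gamma (R : realType) (s : R) : R :=
  \int[@lebesgue_measure R]_(t in `]0, +oo[) (t `^ (s - 1) * expR (- t)).

(* The series is a limit in [R[i]^o], i.e. for the modulus on [R[i]]. *)
Definition bessel_j (R : realType) (a : R) (z : R[i]) : R[i] :=
  (Gamma (a + 1))%:C *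
  limn (series (fun n : nat =>
    (-1) ^+ n * (z / 2) ^+ (2 * n) / (n`!%:R * (Gamma (n%:R + a + 1))%:C)
    : R[i]^o)).

Definition dunkl_kernelC (R : realType) (nu lam x : R) : R[i] :=
  let z := 'i * (lam * x)%:C in
  bessel_j (nu - 2^-1) z
  + (lam * x / (2 * nu + 1))%:C * bessel_j (nu + 2^-1) z.

(* The kernel is real at real arguments, see [dunkl_kernelE] below. *)
Definition dunkl_kernel (R : realType) (nu lam x : R) : R :=
  complex.Re (dunkl_kernelC nu lam x).

Lemma real_limn (R : realType) (u : nat -> R[i]^o) :
  (forall n, (u n : R[i]) \is Num.real) -> (limn u : R[i]) \is Num.real.
Proof.
move=> u_real; have [cu|du] := pselect (cvg (u @ \oo)); last first.
  by rewrite (dvgP du); exact: real0.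
set l := limn u.
have ul : u @ \oo --> (l : R[i]^o) by exact: cu.
case: {cu} l ul => a b ul; rewrite complex_real; apply: contrapT => /negP b0.
have e0 : 0 < `|b|%:C :> R[i] by rewrite ltcR normr_gt0.
move/cvgrPdist_lt: ul => /(_ _ e0)[N _ /(_ N (leqnn N))] /=.
have /complex_realP[k ->] := u_real N.
have := normc_ge_Re (((a +i* b) - k%:C) * 'i).
rewrite ReiNIm normrN /= subr0 normrM [X in _ * X]normc_def /=.
rewrite expr0n add0r expr1n sqrtr1 mulr1 => ble.
by move=> /(le_lt_trans ble); rewrite ltxx.
Qed.

Lemma bessel_j_real (R : realType) (a t : R) :
  bessel_j a ('i * t%:C) \is Num.real.
Proof.
have RC (r : R) : r%:C \is Num.real by apply/complex_realP; exists r.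
have z2_real : ('i * t%:C / 2) ^+ 2 \is Num.real.
  rewrite !exprMn sqr_i; apply: realM; last by rewrite realX// realV realn.
  by apply: realM; rewrite ?realX ?RC// realN real1.
rewrite realM ?RC//; apply: real_limn => n.
rewrite /series /=; apply: rpred_sum => k _.
apply: realM; last first.
  by rewrite realV; apply: realM; [rewrite realn|exact: RC].
apply: realM; last by rewrite exprM realX.
by rewrite realX// realN real1.
Qed.

Lemma dunkl_kernelE (R : realType) (nu lam x : R) :
  (dunkl_kernel nu lam x)%:C = dunkl_kernelC nu lam x.
Proof.
apply: RRe_real; apply: realD; first exact: bessel_j_real.
apply: realM; last exact: bessel_j_real.
by apply/complex_realP; eexists.
Qed.

Definition dunkl_c (R : realType) (nu : R) : R :=
  Gamma (nu + 2^-1) / (Gamma 2^-1 * Gamma nu).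

Definition normalized_dunkl_kernel (R : realType) (nu lam x : R) : R :=
  (dunkl_c nu)^-1 * dunkl_kernel nu lam x.

(* Positivity is part of log-convexity; [powR] is the genuine power only on
   nonnegative bases. *)
Definition log_convex_on (R : realType) (D : set R) (f : R -> R) : Prop :=
  (forall s, D s -> 0 < f s) /\
  (forall s t a, D s -> D t -> 0 <= a <= 1 ->
     f (a * s + (1 - a) * t) <= f s `^ a * f t `^ (1 - a)).

(* Main.v *)
(** The normalized kernel has the integral representation
      c(nu)^-1 E_nu(lam, x) = \int_(-1)^1 e^(y t) (1 - t^2)^(nu - 1) (1 + t) dt,
    with [y = lam * x], whose integrand is positive and log-affine in [nu], so
    that log-convexity is Hoelder's inequality. Folding [t] and [- t] together
    and substituting [t ^+ 2 = v / (1 + v)] turns it into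
      1/2 \int_0^oo ((1 + t) e^(y t) + (1 - t) e^(- y t))
                    v^(-1/2) (1 + v)^(-1/2 - nu) dv,
    the form used here. Expanding the exponentials and integrating term by
    term produces the Beta integrals
      \int_0^oo v^(a - 1) (1 + v)^(- a - b) dv = Gamma a Gamma b / Gamma (a + b)
    at half-integers [a], i.e. the two Bessel series. The Beta integral comes
    from Tonelli's theorem and the scaling t -> c t; its case [a = 1] gives the
    functional equation of Gamma. *)

Require Import Defs.
From HB Require Import structures.
From mathcomp Require Import all_boot all_order all_algebra.
From mathcomp Require Import ring lra.
From mathcomp Require Import complex.
From mathcomp Require Import all_classical all_reals all_analysis.
From mathcomp Require Import measurable_realfun.
Set Implicit Arguments.
Unset Strict Implicit.
Unset Printing Implicit Defensive.
Import Order.TTheory GRing.Theory Num.Theory.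
Import numFieldNormedType.Exports.
Local Open Scope classical_set_scope.
Local Open Scope ring_scope.

(** * Integration over the half-line *)

Section half_line.
Context {R : realType}.
Local Open Scope ereal_scope.
Notation mu := (@lebesgue_measure R).
Notation P := (`]0%R, +oo[%classic : set R).

(** Multiplied by [c], the pushforward gives each interval ]a, b] the length b - a, so it is
    Lebesgue measure by uniqueness. *)
Lemma lebesgue_measure_scale (c : R) (c0 : (0 <= c^-1)%R) (A : set R) :
  (0 < c)%R -> measurable A ->
  mscale (NngNum c0) (@lebesgue_measure R) A =
  pushforward mu ( *%R c : _ -> measurableTypeR R) A.
Proof.
move=> c_gt0 mA.
have -> : pushforward mu ( *%R c : _ -> measurableTypeR R) A = c^-1%:E *
    pushforward (mscale (NngNum (ltW c_gt0)) mu)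
      ( *%R c : _ -> measurableTypeR R) A.
  by rewrite /pushforward /mscale/= muleA -EFinM mulVf ?gt_eqF// mul1e.
rewrite [LHS]/mscale; congr (_ * _).
apply: lebesgue_measure_unique => //= _ [[a b] _ <-].
rewrite /pushforward /mscale/=.
have -> : ( *%R c : _ -> measurableTypeR R) @^-1` `]a, b]%classic =
    `](a / c)%R, (b / c)%R]%classic.
  apply/seteqP; split => x/=; rewrite !in_itv/= ltr_pdivrMr// ler_pdivlMr//;
    by rewrite (mulrC x).
rewrite !lebesgue_measure_itv/= !lte_fin ltr_pM2r ?invr_gt0//.
case: ifPn => _; last by rewrite mule0.
by rewrite -!EFinB -EFinM; congr EFin; field; rewrite gt_eqF.
Qed.

(** The half-line is its own preimage under multiplication by [c], so the substitution only rescales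
    the measure. *)
Lemma ge0_integral_scale (c : R) (f : R -> \bar R) : (0 < c)%R ->
  measurable_fun P f -> (forall t, P t -> 0 <= f t) ->
  \int[mu]_(t in P) f (c * t)%R = (c^-1)%:E * \int[mu]_(t in P) f t.
Proof.
move=> c0 mf f0.
have ic0 : (0 <= c^-1)%R by rewrite invr_ge0 ltW.
have fin_ : {in P, forall y, 0 <= f y} by move=> y /[!inE]; exact: f0.
rewrite -(@ge0_integral_mscale _ _ _ mu P _ (NngNum ic0) f)//.
have -> : \int[mu]_(t in P) f (c * t)%R =
   \int[mu]_(t in ( *%R c : _ -> measurableTypeR R) @^-1` P) (f \o *%R c) t.
  congr (integral _ _ _); apply/seteqP.
  by split => x/=; rewrite !in_itv/= !andbT pmulr_rgt0.
rewrite -ge0_integral_pushforward//.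
apply: eq_measure_integral => A mA _.
exact/esym/lebesgue_measure_scale.
Qed.

(** Indicators extend the integrand by zero to the whole plane, where Tonelli's theorem applies. *)
Lemma tonelli_half_line (f : R -> R -> \bar R) :
  measurable_fun setT (fun z : R * R => f z.1 z.2) ->
  (forall x y, 0 <= f x y) ->
  \int[mu]_(x in P) \int[mu]_(y in P) f x y =
  \int[mu]_(y in P) \int[mu]_(x in P) f x y.
Proof.
move=> mf f0.
pose g (z : R * R) := f z.1 z.2 * ((\1_P z.1)%:E * (\1_P z.2)%:E).
rewrite integral_mkcond [RHS]integral_mkcond.
transitivity (\int[mu]_x \int[mu]_y g (x, y)).
  apply: eq_integral => x _; rewrite patchE; case: ifPn => Px; last first.
    by rewrite integral0_eq// => y _; rewrite /g/= indicE (negbTE Px) mul0e mule0.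
  rewrite integral_mkcond; apply: eq_integral => y _.
  by rewrite patchE /g/= !indicE Px mul1e; case: ifPn; rewrite ?mule1 ?mule0.
transitivity (\int[mu]_y \int[mu]_x g (x, y)); last first.
  apply/esym; apply: eq_integral => y _; rewrite patchE; case: ifPn => Py; last first.
    rewrite integral0_eq// => x _.
    by rewrite /g/= [\1_P y]indicE (negbTE Py) !mule0.
  rewrite integral_mkcond; apply: eq_integral => x _.
  by rewrite patchE /g/= !indicE Py mule1; case: ifPn; rewrite ?mule1 ?mule0.
apply: (@fubini_tonelli _ _ _ _ _ mu mu g).
- apply: emeasurable_funM => //; apply/measurable_EFinP; apply: measurable_funM.
  + exact: (@measurableT_comp _ _ _ _ _ _ (\1_P : R -> R)).
  + exact: (@measurableT_comp _ _ _ _ _ _ (\1_P : R -> R)).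
- by move=> z; rewrite mule_ge0// mule_ge0// lee_fin.
Qed.

(** A zero integral would make [f] vanish almost everywhere on the half-line, which would then be a
    null set; its measure is infinite. *)
Lemma gt0_integral_half_line (f : R -> R) : measurable_fun P f ->
  (forall t, P t -> 0 < f t)%R -> 0 < \int[mu]_(t in P) (f t)%:E.
Proof.
move=> mf f0.
have f0' t : P t -> 0 <= (f t)%:E by move=> /f0 /ltW; rewrite lee_fin.
rewrite lt0e integral_ge0// andbT; apply/eqP => i0.
have : ae_eq mu P (EFin \o f) (cst 0).
  apply/ae_eq_integral_abs => //; first exact/measurable_EFinP.
  rewrite -[RHS]i0; apply: eq_integral => t /[!inE] Pt.
  by rewrite gee0_abs// f0'.
move=> [N [mN N0 PN]].
have : mu P <= mu N.
  apply: le_measure => //; rewrite ?inE// => t Pt; apply: PN => /(_ Pt)[] ft.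
  by have := f0 _ Pt; rewrite ft ltxx.
by rewrite N0 lebesgue_measure_itv/= ltry leye_eq.
Qed.

End half_line.

(** * The Gamma and Beta integrals *)

Section Gamma_Beta.
Context {R : realType}.
Local Open Scope ereal_scope.
Notation mu := (@lebesgue_measure R).
Notation P := (`]0%R, +oo[%classic : set R).
Implicit Types a b c s : R.

(** Values are kept in the extended reals so that Tonelli's theorem can be used before Gamma is
    known to be finite. *)
Definition eGamma s := \int[mu]_(t in P) (t `^ (s - 1) * expR (- t))%:E.

(** The Euler Beta integral over ]0, 1[ after the substitution t = v / (1 + v). *)
Definition eBeta a b :=
  \int[mu]_(v in P) (v `^ (a - 1) * (1 + v) `^ (- (a + b)))%:E.

Lemma measurable_powR_comp d (T : measurableType d) (D : set T) (f : T -> R) s :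
  measurable_fun D f -> measurable_fun D (fun x => f x `^ s)%R.
Proof. by move=> mf; apply: (measurableT_comp (measurable_powR s)). Qed.

Lemma measurable_expR_comp d (T : measurableType d) (D : set T) (f : T -> R) :
  measurable_fun D f -> measurable_fun D (fun x => expR (f x))%R.
Proof. by move=> mf; apply: (measurableT_comp (@measurable_expR R)). Qed.

Lemma measurable_Gamma_integrand c s (D : set R) :
  measurable_fun D (fun t : R => t `^ (s - 1) * expR (- (c * t)))%R.
Proof.
apply: measurable_funM; first exact: measurable_powR_comp.
by apply/measurable_expR_comp/measurableT_comp => //; exact: measurable_funM.
Qed.

Lemma measurable_Beta_integrand p q (D : set R) :
  measurable_fun D (fun v : R => v `^ p * (1 + v) `^ q)%R.
Proof.
by apply: measurable_funM; apply: measurable_powR_comp => //; exact: measurable_funD.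
Qed.

Lemma eGamma_scale c s : (0 < c)%R ->
  \int[mu]_(t in P) (t `^ (s - 1) * expR (- (c * t)))%:E =
  (c `^ (- s))%:E * eGamma s.
Proof.
move=> c0; have c0' := ltW c0; have cn0 : c != 0%R by rewrite gt_eqF.
have mG : measurable_fun P (fun t : R => (t `^ (s - 1) * expR (- t))%:E).
  apply/measurable_EFinP; have := @measurable_Gamma_integrand 1 s P.
  by apply: eq_measurable_fun => t _; rewrite mul1r.
(* The factor [c^-1] is the Jacobian of t -> c t; the other one cancels the power of [c] coming out
   of (c t)^(s - 1). *)
have -> : (c `^ (- s) = c `^ (1 - s) * c^-1)%R.
  by rewrite -[X in (_ * X)%R]powR_inv1// -powRD ?cn0 ?implybT//; congr powR; ring.
rewrite EFinM -muleA.
rewrite -(@ge0_integral_scale _ c (fun t => (t `^ (s - 1) * expR (- t))%:E))//.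
rewrite -ge0_integralZl_EFin ?powR_ge0//.
- apply: eq_integral => t /[!inE]/= /[!in_itv]/= /[!andbT] t0.
  rewrite -EFinM powRM ?(ltW t0)//; congr EFin.
  rewrite mulrA mulrA -powRD ?cn0 ?implybT//.
  by rewrite (_ : 1 - s + (s - 1) = 0)%R ?powRr0 ?mul1r//; ring.
- by move=> t; rewrite lee_fin mulr_ge0 ?powR_ge0 ?expR_ge0.
- apply/measurable_EFinP; apply: (@measurable_funM _ _ _ _
    (fun t => (c * t) `^ (s - 1)) (fun t => expR (- (c * t))))%R.
    by apply: measurable_powR_comp; exact: measurable_funM.
  by apply/measurable_expR_comp/measurableT_comp => //; exact: measurable_funM.
- by move=> t _; rewrite lee_fin mulr_ge0 ?powR_ge0 ?expR_ge0.
Qed.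

(** The kernel [K] is integrated in both orders. Over [v] first, scaling by t yields Gamma a times
    the integrand of Gamma b; over [t] first, scaling by 1 + v yields Gamma (a + b) times the Beta
    integrand. *)
Lemma eGammaM a b : eGamma a * eGamma b = eGamma (a + b) * eBeta a b.
Proof.
pose K (t v : R) :=
  (t `^ (b - 1) * expR (- t) * (t `^ a * (v `^ (a - 1) * expR (- (t * v)))))%R.
have K0 t v : (0 <= K t v)%R by rewrite !mulr_ge0 ?powR_ge0 ?expR_ge0.
have mK : measurable_fun setT (fun z : R * R => (K z.1 z.2)%:E).
  apply/measurable_EFinP; apply: measurable_funM.
    apply: measurable_funM; first exact: measurable_powR_comp.
    by apply/measurable_expR_comp/measurableT_comp.
  apply: measurable_funM; first exact: measurable_powR_comp.
  apply: measurable_funM; first exact: measurable_powR_comp.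
  apply/measurable_expR_comp/measurableT_comp => //.
  exact: measurable_funM.
have KG (t : R) : P t -> \int[mu]_(v in P) (K t v)%:E =
    (t `^ (b - 1) * expR (- t))%:E * eGamma a.
  move=> /=; rewrite in_itv/= andbT => t0; rewrite /K.
  under eq_integral do rewrite mulrA EFinM.
  rewrite ge0_integralZl_EFin//; last 3 first.
  - by move=> v _; rewrite lee_fin mulr_ge0 ?powR_ge0 ?expR_ge0.
  - by apply/measurable_EFinP; exact: measurable_Gamma_integrand.
  - by rewrite !mulr_ge0 ?powR_ge0 ?expR_ge0.
  rewrite eGamma_scale// muleA -EFinM; congr (_%:E * _).
  rewrite -[LHS]mulrA -powRD; last by rewrite (gt_eqF t0) implybT.
  by rewrite subrr powRr0 mulr1.
have KB (v : R) : P v -> \int[mu]_(t in P) (K t v)%:E =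
    eGamma (a + b) * (v `^ (a - 1) * (1 + v) `^ (- (a + b)))%:E.
  move=> /=; rewrite in_itv/= andbT => v0.
  have v1 : (0 < 1 + v)%R by rewrite addr_gt0.
  rewrite [RHS]muleC EFinM -[RHS]muleA -[X in _ = _ * X](eGamma_scale _ v1).
  rewrite -ge0_integralZl_EFin ?powR_ge0//; last 2 first.
  - by move=> t _; rewrite lee_fin mulr_ge0 ?powR_ge0 ?expR_ge0.
  - by apply/measurable_EFinP; exact: measurable_Gamma_integrand.
  apply: eq_integral => t /[!inE]/= /[!in_itv]/= /[!andbT] t0.
  rewrite -EFinM /K; congr EFin.
  rewrite (_ : a + b - 1 = b - 1 + a)%R; last by ring.
  rewrite (@powRD _ t (b - 1) a) ?(gt_eqF t0) ?implybT//.
  rewrite (_ : - ((1 + v) * t) = - t + - (t * v))%R; last by ring.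
  by rewrite expRD; ring.
transitivity (\int[mu]_(t in P) \int[mu]_(v in P) (K t v)%:E).
  rewrite muleC -ge0_integralZr//; last 3 first.
  - have := @measurable_Gamma_integrand 1 b P.
    by move=> /measurable_EFinP; apply: eq_measurable_fun => t _ /=; rewrite mul1r.
  - by move=> t _; rewrite lee_fin mulr_ge0 ?powR_ge0 ?expR_ge0.
  - by apply: integral_ge0 => t _; rewrite lee_fin mulr_ge0 ?powR_ge0 ?expR_ge0.
  by apply: eq_integral => t /[!inE] Pt; rewrite KG.
rewrite (@tonelli_half_line _ (fun t v => (K t v)%:E))//.
rewrite -ge0_integralZl//; last 3 first.
- by apply/measurable_EFinP; exact: measurable_Beta_integrand.
- by move=> t _; rewrite lee_fin mulr_ge0 ?powR_ge0.
- by apply: integral_ge0 => t _; rewrite lee_fin mulr_ge0 ?powR_ge0 ?expR_ge0.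
by apply: eq_integral => v /[!inE] Pv; rewrite KB.
Qed.

End Gamma_Beta.

(** * Gamma and Beta at a = 1 *)

Section Gamma_Beta_values.
Context {R : realType}.
Local Open Scope ereal_scope.
Notation mu := (@lebesgue_measure R).
Notation P := (`]0%R, +oo[%classic : set R).
Implicit Types a b c s : R.

Lemma eGamma1 : eGamma 1 = 1 :> \bar R.
Proof.
rewrite /eGamma.
under eq_integral do rewrite subrr powRr0 mul1r.
rewrite integral_itv_obnd_cbnd; last first.
  by apply/measurable_EFinP; apply: measurable_expR_comp.
have d (x : R) : is_derive x 1%R (fun t : R => - expR (- t))%R (expR (- x))%R.
  have H := is_deriveN (is_derive1_comp (is_derive_expR (- x)%R)
    (is_deriveN (is_derive_id x 1%R))).
  by apply: (is_derive_eq H); rewrite mulrN1 opprK.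
have cE : continuous (fun t : R => expR (- t))%R.
  by move=> x; apply: continuous_comp; [exact: continuousN|exact: continuous_expR].
rewrite (@ge0_continuous_FTC2y _ _ (fun t => - expR (- t))%R 0%R 0%R).
- by rewrite oppr0 expR0 -EFinB sub0r opprK.
- by move=> x _; exact: expR_ge0.
- exact: continuous_subspaceT.
- by rewrite -oppr0; apply: cvgN; exact: cvgr_expR.
- by move=> x _; have := d x => -[].
- apply: cvg_at_right_filter; apply: cvgN; exact: cE.
- by move=> x _; rewrite derive1E; apply: derive_val.
Qed.

Lemma powRN_cvgy b : (0 < b)%R -> ((1 + v) `^ (- b))%R @[v --> +oo%R] --> (0:R)%R.
Proof.
move=> b0; apply/cvgrPdist_lt => e e0; near=> v.
have v0 : (0 < v)%R by near: v; exact: nbhs_pinfty_gt.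
rewrite sub0r normrN ger0_norm ?powR_ge0//.
(* With [e] written as a power of exponent - b, the inequality holds as soon as v exceeds
   e^(-1/b). *)
have -> : e = ((e `^ (- b^-1)) `^ (- b))%R.
  by rewrite -powRrM mulrNN mulVf ?gt_eqF// powRr1// ltW.
rewrite !(powRN _ b) ltf_pV2 ?posrE ?powR_gt0 ?addr_gt0//.
apply: gt0_ltr_powR; rewrite ?nnegrE ?powR_ge0//; first by rewrite addr_ge0 // ltW.
apply: (@lt_trans _ _ v); last by rewrite ltrDr.
by near: v; apply: nbhs_pinfty_gt; rewrite num_real.
Unshelve. all: by end_near. Qed.

Lemma eBeta1 b : (0 < b)%R -> eBeta 1 b = (b^-1)%:E.
Proof.
move=> b0; rewrite /eBeta.
under eq_integral do rewrite subrr powRr0 mul1r.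
have md (D : set R) : measurable_fun D (fun v : R => (1 + v) `^ (- (1 + b)))%R.
  by apply: measurable_powR_comp; exact: measurable_funD.
rewrite integral_itv_obnd_cbnd; last exact/measurable_EFinP.
have d1 (x : R) : is_derive x 1%R (fun v : R => 1 + v)%R 1%R.
  have H := is_deriveD (is_derive_cst (1 : R)%R x 1%R) (is_derive_id x 1%R).
  by apply: (is_derive_eq H); rewrite add0r.
(* The primitive is differentiable on ]-1, +oo[, which contains the endpoint 0 in its interior; its
   limit at 0 from the right is thus its value there. *)
have d (x : R) : (-1 < x)%R ->
    is_derive x 1%R (fun v : R => - b^-1 * (1 + v) `^ (- b))%R
      ((1 + x) `^ (- (1 + b)))%R.
  move=> x1; have x0 : (0 < 1 + x)%R by lra.
  have H := is_deriveZ (- b^-1)%R (is_derive1_comp (is_derive1_powR (- b) x0) (d1 x)).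
  apply: (is_derive_eq H).
  rewrite mulr1 /GRing.scale/= mulrA mulrNN mulVf ?gt_eqF// mul1r.
  by congr powR; ring.
have cE (x : R) : (-1 < x)%R ->
    {for x, continuous (fun v : R => (1 + v) `^ (- (1 + b)))%R}.
  move=> x1; have x0 : (0 < 1 + x)%R by lra.
  apply: differentiable_continuous; apply/derivable1_diffP.
  by have [] := is_derive1_comp (is_derive1_powR (- (1 + b)) x0) (d1 x).
have N10 : (-1 < 0 :> R)%R by lra.
rewrite (@ge0_continuous_FTC2y _ _ (fun v => - b^-1 * (1 + v) `^ (- b))%R 0%R 0%R).
- by rewrite addr0 powR1 -EFinB sub0r mulNr mulr1 opprK.
- by move=> x _; exact: powR_ge0.
- apply/continuous_within_itvcyP; split.
    by move=> x; rewrite in_itv/= andbT => x0; apply: cE; exact: lt_trans x0.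
  by apply: cvg_at_right_filter; exact: cE.
- rewrite -[X in _ --> X](mulr0 (- b^-1)%R); apply: cvgM; first exact: cvg_cst.
  exact: powRN_cvgy.
- by move=> x x0; have [] := d x (lt_trans N10 x0).
- apply: cvg_at_right_filter; have [H _] := d 0%R N10.
  by move/derivable1_diffP/differentiable_continuous : H.
- move=> x; rewrite in_itv/= andbT => x0; rewrite derive1E.
  by have [] := d x (lt_trans N10 x0).
Qed.

End Gamma_Beta_values.

(** * Finiteness, functional equation and half-integer values of Gamma *)

Section Gamma_values.
Context {R : realType}.
Local Open Scope ereal_scope.
Notation mu := (@lebesgue_measure R).
Notation P := (`]0%R, +oo[%classic : set R).
Implicit Types a b c s : R.

Lemma measurable_eGamma_integrand s :
  measurable_fun P (fun t : R => t `^ (s - 1) * expR (- t))%R.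
Proof.
have := @measurable_Gamma_integrand R 1 s P.
by apply: eq_measurable_fun => t _ /=; rewrite mul1r.
Qed.

Lemma eGamma_gt0 s : 0 < eGamma s.
Proof.
apply: gt0_integral_half_line; first exact: measurable_eGamma_integrand.
by move=> t /= /[!in_itv]/= /[!andbT] t0; rewrite mulr_gt0 ?powR_gt0 ?expR_gt0.
Qed.

(** [eGammaM] at a = 1, where the Beta integral is 1/s, replaces the usual integration by parts. *)
Lemma eGammaS s : (0 < s)%R -> eGamma (s + 1) = s%:E * eGamma s.
Proof.
move=> s0; have := eGammaM 1 s; rewrite eGamma1 mul1e eBeta1// addrC => ->.
by rewrite muleCA -EFinM mulfV ?gt_eqF// mule1.
Qed.

Lemma eGamma_nat_fin n : eGamma n.+1%:R < +oo :> \bar R.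
Proof.
elim: n => [|n IHn]; first by rewrite eGamma1 ltry.
by rewrite -[n.+2%:R]natr1 eGammaS// lte_mul_pinfty// lee_fin.
Qed.

Lemma eGamma_fin s : (0 < s)%R -> eGamma s \is a fin_num.
Proof.
move=> s0; rewrite gt0_fin_numE ?eGamma_gt0//.
(* The relation Gamma s = Gamma (s + 1) / s moves the argument above 1, where the integrand is
   bounded near 0. *)
suff H (r : R) : (1 <= r)%R -> eGamma r < +oo.
  have := eGammaM 1 s; rewrite eGamma1 mul1e eBeta1// => ->.
  rewrite muleC lte_mul_pinfty ?lee_fin ?invr_ge0 ?ltW// H// lerDl ltW//.
move=> r1; have [n rn] : exists n : nat, (r - 1 <= n%:R)%R.
  by exists (Num.bound (r - 1)); rewrite ltW// archi_boundP// subr_ge0.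
have mG q : measurable_fun P (fun t : R => (t `^ (q - 1) * expR (- t))%:E).
  by apply/measurable_EFinP; exact: measurable_eGamma_integrand.
have G0 q (t : R) : 0 <= (t `^ (q - 1) * expR (- t))%:E.
  by rewrite lee_fin mulr_ge0 ?powR_ge0 ?expR_ge0.
(* Here t^(r - 1) <= t^0 + t^n: the first term dominates for t <= 1, the second for t > 1. *)
apply: (@le_lt_trans _ _ (eGamma 1 + eGamma n.+1%:R)); last first.
  by apply: lte_add_pinfty; [rewrite eGamma1 ltry|exact: eGamma_nat_fin].
rewrite /eGamma -ge0_integralD//; [|exact: mG|exact: mG].
apply: ge0_le_integral => //; [exact: mG|by apply: emeasurable_funD; exact: mG|].
move=> t /= /[!in_itv]/= /[!andbT] t0.
rewrite -EFinD lee_fin -mulrDl ler_wpM2r ?expR_ge0//.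
rewrite subrr powRr0 -natr1 addrK.
have [t1|t1] := leP t 1%R.
  rewrite (@le_trans _ _ (t `^ 0))%R ?ger_powR ?t0 ?t1 ?subr_ge0//.
  by rewrite powRr0 lerDl powR_ge0.
by rewrite (@le_trans _ _ (t `^ n%:R)%R) ?ler_powR ?(ltW t1)// lerDr.
Qed.

Lemma EFin_Gamma s : (0 < s)%R -> (Gamma s)%:E = eGamma s.
Proof. by move=> s0; rewrite fineK// eGamma_fin. Qed.

Lemma Gamma_gt0 s : (0 < s)%R -> (0 < Gamma s)%R.
Proof. by move=> s0; rewrite -lte_fin EFin_Gamma// eGamma_gt0. Qed.

Lemma GammaS s : (0 < s)%R -> Gamma (s + 1) = (s * Gamma s)%R.
Proof.
move=> s0; apply: EFin_inj; rewrite EFinM !EFin_Gamma ?addr_gt0//.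
exact: eGammaS.
Qed.

Lemma eBetaE a b : (0 < a)%R -> (0 < b)%R ->
  eBeta a b = (Gamma a * Gamma b / Gamma (a + b))%:E.
Proof.
move=> a0 b0; have ab0 := addr_gt0 a0 b0.
have G0 := Gamma_gt0 ab0.
rewrite EFinM EFinM !EFin_Gamma// eGammaM -EFin_Gamma// muleAC -EFinM.
by rewrite mulfV ?gt_eqF// mul1e.
Qed.

(** In the termwise integrals, this (2n)! cancels the one of the exponential series and leaves the
    n! of the Bessel series. *)
Lemma Gamma_half_nat n :
  Gamma (n%:R + 2^-1) = ((2 * n)`!%:R / (4 ^+ n * n`!%:R) * Gamma 2^-1 :> R)%R.
Proof.
elim: n => [|n IHn]; first by rewrite muln0 expr0 fact0 mulr1 divr1 mul1r add0r.
have h0 : (0 < n%:R + 2^-1 :> R)%R by rewrite ltr_wpDl// invr_gt0.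
rewrite -natr1 addrAC GammaS// IHn mulnS !factS exprS !natrM -!natr1.
rewrite natrM.
field.
by rewrite add0r natr1 !pnatr_eq0 -lt0n fact_gt0/= expf_neq0// -!natrD pnatr_eq0.
Qed.

End Gamma_values.

(** * Even and odd parts of the exponential series *)

Section exp_parity.
Context {R : realType}.
Implicit Types (z y : R).

(** Averaging the exponential series at z and - z cancels the odd terms. Limits and bounds of the
    even part are then inherited from the exponential; the odd part is treated alike with a
    difference. *)
Lemma series_even_exp_coeff z N :
  series (fun n => exp_coeff z (2 * n)%N) N =
  (series (exp_coeff z) (2 * N)%N + series (exp_coeff (- z)) (2 * N)%N) / 2.
Proof.
elim: N => [|N IHN]; first by rewrite /series/= !big_geq// addr0 mul0r.
rewrite mulnS add2n !seriesSr IHN.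
rewrite /exp_coeff/= [(- z) ^+ (2 * N).+1]exprS [(- z) ^+ (2 * N)]exprM.
by rewrite sqrrN -exprM exprS; field; rewrite !pnatr_eq0 -!lt0n !fact_gt0.
Qed.

Lemma series_odd_exp_coeff z N :
  series (fun n => exp_coeff z (2 * n).+1%N) N =
  (series (exp_coeff z) (2 * N)%N - series (exp_coeff (- z)) (2 * N)%N) / 2.
Proof.
elim: N => [|N IHN]; first by rewrite /series/= !big_geq// subr0 mul0r.
rewrite mulnS add2n !seriesSr IHN.
rewrite /exp_coeff/= [(- z) ^+ (2 * N).+1]exprS [(- z) ^+ (2 * N)]exprM.
by rewrite sqrrN -exprM exprS; field; rewrite !pnatr_eq0 -!lt0n !fact_gt0.
Qed.

Lemma cvg_series_exp_coeff_double z :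
  series (exp_coeff z) (2 * N)%N @[N --> \oo] --> expR z.
Proof.
have H : series (exp_coeff z) @ \oo --> expR z by exact: is_cvg_series_exp_coeff.
apply: (cvg_comp (fun N : nat => (2 * N)%N) (series (exp_coeff z)) _ H).
move=> A [N _ NA]; exists N => // n /= Nn; apply: NA => /=.
by rewrite (leq_trans Nn)// leq_pmull.
Qed.

Lemma cvg_even_exp_coeff z :
  series (fun n => exp_coeff z (2 * n)%N) @ \oo --> (expR z + expR (- z)) / 2.
Proof.
rewrite (_ : series _ = fun N => (series (exp_coeff z) (2 * N)%N
   + series (exp_coeff (- z)) (2 * N)%N) / 2); last first.
  by apply/funext => N; rewrite series_even_exp_coeff.
apply: cvgM; last exact: cvg_cst.
by apply: cvgD; exact: cvg_series_exp_coeff_double.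
Qed.

Lemma cvg_odd_exp_coeff z :
  series (fun n => exp_coeff z (2 * n).+1%N) @ \oo --> (expR z - expR (- z)) / 2.
Proof.
rewrite (_ : series _ = fun N => (series (exp_coeff z) (2 * N)%N
   - series (exp_coeff (- z)) (2 * N)%N) / 2); last first.
  by apply/funext => N; rewrite series_odd_exp_coeff.
apply: cvgM; last exact: cvg_cst.
by apply: cvgB; exact: cvg_series_exp_coeff_double.
Qed.

Lemma normr_series_exp_coeff z N : `|series (exp_coeff z) N| <= expR `|z|.
Proof.
apply: (@le_trans _ _ (series (exp_coeff `|z|) N)).
  rewrite /series/= (le_trans (ler_norm_sum _ _ _))// ler_sum// => n _.
  by rewrite normrM normrX normfV [`|n`!%:R|]ger0_norm.
apply: nondecreasing_cvgn_le; last exact: is_cvg_series_exp_coeff.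
apply/nondecreasing_seqP => n.
by rewrite seriesSr lerDl exp_coeff_ge0.
Qed.

Lemma normr_even_exp_coeff z N :
  `|series (fun n => exp_coeff z (2 * n)%N) N| <= expR `|z|.
Proof.
rewrite series_even_exp_coeff normrM normfV [`|2|]ger0_norm// ler_pdivrMr//.
rewrite (le_trans (ler_normD _ _))// mulr_natr mulr2n lerD//.
  exact: normr_series_exp_coeff.
by rewrite -[X in expR X]normrN normr_series_exp_coeff.
Qed.

Lemma normr_odd_exp_coeff z N :
  `|series (fun n => exp_coeff z (2 * n).+1%N) N| <= expR `|z|.
Proof.
rewrite series_odd_exp_coeff normrM normfV [`|2|]ger0_norm// ler_pdivrMr//.
rewrite (le_trans (ler_normB _ _))// mulr_natr mulr2n lerD//.
  exact: normr_series_exp_coeff.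
by rewrite -[X in expR X]normrN normr_series_exp_coeff.
Qed.

End exp_parity.

(** * Termwise integration of a series with uniformly bounded partial sums *)

Section dominated_series.
Context d (T : measurableType d) (R : realType).
Variables (mu : {measure set T -> \bar R}) (D : set T) (mD : measurable D).
Variables (u : nat -> T -> R) (h w : T -> R) (M : R).
Hypothesis measurable_u : forall n, measurable_fun D (u n).
Hypothesis mh : measurable_fun D h.
Hypothesis iw : mu.-integrable D (EFin \o w).
Hypothesis w0 : forall x, D x -> 0 <= w x.
Hypothesis uM : forall x N, D x -> `|series (u ^~ x) N| <= M.
Hypothesis uh : forall x, D x -> series (u ^~ x) @ \oo --> h x.

Let mw : measurable_fun D w.
Proof. by have /measurable_EFinP := measurable_int mu iw. Qed.

Let iMw (k : R) : mu.-integrable D (EFin \o (fun x => k * w x)).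
Proof. exact: (integrableZl mD k iw). Qed.

Let iu n : mu.-integrable D (EFin \o (fun x => u n x * w x)).
Proof.
apply: (le_integrable mD _ _ (iMw (M + M))).
  by apply/measurable_EFinP; exact: measurable_funM.
move=> x Dx /=; rewrite lee_fin normrM [leRHS]normrM ler_wpM2r//.
rewrite (le_trans _ (ler_norm _))//.
(* A term is a difference of two partial sums, whence the bound [M + M]. *)
have -> : u n x = series (u ^~ x) n.+1 - series (u ^~ x) n.
  by rewrite seriesSB.
by rewrite (le_trans (ler_normB _ _))// lerD// uM.
Qed.

(** Both claims go through one induction, since additivity of the real-valued integral requires
    integrability of the previous partial sum. *)
Let isu N : mu.-integrable D (EFin \o (fun x => series (u ^~ x) N * w x)) /\
  \int[mu]_(x in D) (series (u ^~ x) N * w x) =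
  series (fun n => \int[mu]_(x in D) (u n x * w x)) N.
Proof.
elim: N => [|N [iN eN]].
  rewrite [in RHS]/series/= big_geq//; split.
    rewrite (_ : _ \o _ = cst 0%E); first exact: integrable0.
    by apply/funext => x/=; rewrite /series/= big_geq// mul0r.
  under eq_Rintegral do rewrite /series/= big_geq// mul0r.
  by rewrite Rintegral_cst// mul0r.
have E x : series (u ^~ x) N.+1 * w x = series (u ^~ x) N * w x + u N x * w x.
  by rewrite seriesSr mulrDl.
split.
  have := integrableD mD iN (iu N); congr (_.-integrable _ _).
  by apply/funext => x /=; rewrite E.
under eq_Rintegral do rewrite E.
by rewrite RintegralD// eN seriesSr.
Qed.

Lemma dominated_series_integrable : mu.-integrable D (EFin \o (fun x => h x * w x)).
Proof.
apply: (le_integrable mD _ _ (iMw M)).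
  by apply/measurable_EFinP; exact: measurable_funM.
move=> x Dx /=; rewrite lee_fin normrM [leRHS]normrM ler_wpM2r//.
rewrite (le_trans _ (ler_norm _))//.
have c : `|series (u ^~ x) N| @[N --> \oo] --> `|h x|.
  by apply: cvg_norm; exact: uh.
rewrite -(cvg_lim _ c)//.
apply: limr_le; first by apply/cvg_ex; eexists; exact: c.
by apply: nearW => N; exact: uM.
Qed.

(** Dominated convergence for the partial sums, with [M * w] as the dominating function. *)
Lemma dominated_series_cvg :
  series (fun n => \int[mu]_(x in D) (u n x * w x)) @ \oo -->
  \int[mu]_(x in D) (h x * w x).
Proof.
have [|||||_ _] := @dominated_convergence _ _ _ mu D mD
  (fun N x => (series (u ^~ x) N * w x)%:E) (fun x => (h x * w x)%:E)
  (fun x => (M * w x)%:E).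
- by move=> N; have [/measurable_int] := isu N.
- by apply/measurable_EFinP; exact: measurable_funM.
- apply: aeW => x Dx; apply: cvg_EFin; first exact: nearW.
  apply: cvgM; [exact: uh|exact: cvg_cst].
- exact: iMw.
- apply: aeW => x Dx N /=; rewrite lee_fin normrM [X in _ * X]ger0_norm ?w0//.
  by rewrite ler_wpM2r ?w0// uM.
move=> H.
rewrite (_ : series _ = fun N =>
    fine (\int[mu]_(x in D) (series (u ^~ x) N * w x)%:E)); last first.
  by apply/funext => N; have [_ <-] := isu N.
apply: fine_cvg; rewrite fineK//.
exact: (integrable_fin_num mD dominated_series_integrable).
Qed.

End dominated_series.

(** * The Dunkl kernel as a sum of two real series *)

Section bessel_real.
Context {R : realType}.
Local Open Scope complex_scope.
Implicit Types (a y : R).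

Lemma cvg_real_complex (u : nat -> R) (l : R) : u @ \oo --> l ->
  (fun n => (u n)%:C : R[i]^o) @ \oo --> (l%:C : R[i]^o).
Proof.
(* The radius is itself a complex number; being positive, it has zero imaginary part. *)
move=> ul; apply/cvgrPdist_lt => -[e1 e2]; rewrite ltcE/= => /andP[/eqP -> e0].
move/cvgrPdist_lt : ul => /(_ _ e0); apply: filterS => n.
by rewrite -rmorphB/= normc_def/= expr0n/= addr0 sqrtr_sqr ltcR.
Qed.

(** At an imaginary argument the powers of i^2 absorb the alternating signs, leaving the real series
    of the modified Bessel function. *)
Lemma bessel_j_imag a y (l : R) :
  series (fun n => (y / 2) ^+ (2 * n) / (n`!%:R * Gamma (n%:R + a + 1))) @ \oo
    --> l ->
  bessel_j a ('i * y%:C) = (Gamma (a + 1) * l)%:C.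
Proof.
move=> ul; rewrite /bessel_j rmorphM/=; congr (_ * _).
apply: (@cvg_lim R[i]^o); first exact: norm_hausdorff.
move: ul; set v := series _ => ul.
rewrite [X in X @ _](_ : _ = (fun N => (v N)%:C : R[i]^o)).
  exact: cvg_real_complex.
apply/funext => N.
rewrite /series/= rmorph_sum/=; apply: eq_bigr => n _.
rewrite rmorphM fmorphV rmorphM rmorph_nat/=; congr (_ / _).
rewrite -mulrA exprMn exprM sqr_i mulrA -exprMn mulrNN mul1r expr1n mul1r.
by rewrite rmorphXn rmorphM fmorphV rmorph_nat.
Qed.

Lemma cvg_seriesZ (k l : R) (u : nat -> R) : series u @ \oo --> l ->
  series (fun n => k * u n) @ \oo --> k * l.
Proof.
move=> ul; rewrite (_ : series _ = fun N => k * series u N).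
  by apply: cvgM => //; exact: cvg_cst.
by apply/funext => N; rewrite /series/= mulr_sumr.
Qed.

(** Since Gamma (nu + 3/2) = (nu + 1/2) Gamma (nu + 1/2), the coefficient y / (2 nu + 1) becomes y /
    2 and both Bessel terms carry Gamma (nu + 1/2). Dividing by c(nu) trades it for Gamma (1/2)
    Gamma nu. The series have the shape that termwise integration produces. *)
Lemma dunkl_kernel_series nu lam x (S T : R) : 0 < nu ->
  series (fun n => Gamma 2^-1 * Gamma nu * ((lam * x / 2) ^+ (2 * n) /
    (n`!%:R * Gamma (n%:R + 2^-1 + nu)))) @ \oo --> S ->
  series (fun n => Gamma 2^-1 * Gamma nu * (lam * x / 2) *
    ((lam * x / 2) ^+ (2 * n) / (n`!%:R * Gamma (n.+1%:R + 2^-1 + nu)))) @ \oo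
    --> T ->
  normalized_dunkl_kernel nu lam x = S + T.
Proof.
have e1 n : n%:R + 2^-1 + nu = n%:R + (nu - 2^-1) + 1 :> R by field.
have e2 n : n.+1%:R + 2^-1 + nu = n%:R + (nu + 2^-1) + 1 :> R.
  by rewrite -natr1; ring.
have e3 : nu - 2^-1 + 1 = nu + 2^-1 by field.
rewrite /normalized_dunkl_kernel /dunkl_kernel /dunkl_kernelC /dunkl_c.
move: (lam * x) => y nu0.
have h : 0 < nu + 2^-1 by rewrite addr_gt0.
have := Gamma_gt0 nu0; have := @Gamma_gt0 R 2^-1; rewrite invr_gt0 ltr0n => /(_ isT).
move: (Gamma 2^-1) (Gamma nu) => g1 g2 g1_gt0 g2_gt0 HS HT.
have g0 : g1 * g2 != 0 by rewrite gt_eqF// mulr_gt0.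
rewrite (bessel_j_imag (l := (g1 * g2)^-1 * S)); last first.
  move: (cvg_seriesZ (k := (g1 * g2)^-1) HS).
  by under [X in series X]eq_fun do rewrite mulKf// e1.
have -> : (y / (2 * nu + 1))%:C * bessel_j (nu + 2^-1) ('i * y%:C) =
    (Gamma (nu + 2^-1) * ((g1 * g2)^-1 * T))%:C.
  (* At [y = 0] the coefficient vanishes, and the convergence of the second
     Bessel series is not available from [HT]. *)
  have [y0|y0] := eqVneq y 0.
    rewrite y0 !mul0r (_ : T = 0) ?mulr0//.
    move: HT; rewrite [X in X @ _](_ : _ = cst 0).
      by move=> /cvg_lim <-//; rewrite lim_cst.
    apply/funext => N; rewrite /series/= big1// => n _.
    by rewrite y0 mul0r mulr0 mul0r.
  have gy0 : g1 * g2 * (y / 2) != 0 by rewrite mulf_neq0// mulf_neq0// invr_neq0.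
  rewrite (bessel_j_imag (l := (g1 * g2 * (y / 2))^-1 * T)); last first.
    move: (cvg_seriesZ (k := (g1 * g2 * (y / 2))^-1) HT).
    by under [X in series X]eq_fun do rewrite mulKf// e2.
  rewrite GammaS// -rmorphM/=; congr (_%:C).
  move: (Gamma _) => G.
  clear -g1_gt0 g2_gt0 y0 nu0.
  by field; rewrite (gt_eqF g1_gt0) (gt_eqF g2_gt0) y0 /=; lra.
rewrite e3 -rmorphD/=; have := Gamma_gt0 h.
move: (Gamma _) => G G0; clear -g1_gt0 g2_gt0 G0.
by field; rewrite !gt_eqF.
Qed.

End bessel_real.

(** * Log-convexity of integrals *)

Section log_convexity.
Context {R : realType}.

(** Convexity of the exponential at the points ln x and ln y. *)
Lemma young_powR (a x y : R) : 0 <= a <= 1 -> 0 < x -> 0 < y ->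
  x `^ a * y `^ (1 - a) <= a * x + (1 - a) * y.
Proof.
move=> /andP[a0 a1] x0 y0.
have : expR (a * ln x + (1 - a) * ln y) <=
    a * expR (ln x) + (1 - a) * expR (ln y).
  exact: (convex_expR (Itv01 a0 a1) (ln x) (ln y)).
rewrite !lnK// expRD.
by rewrite /powR !gt_eqF.
Qed.

(** Young's inequality for x / F and y / G, multiplied by F^a G^(1 - a). *)
Lemma young_powR_scale (a x y F G : R) :
  0 <= a <= 1 -> 0 < x -> 0 < y -> 0 < F -> 0 < G ->
  x `^ a * y `^ (1 - a) <= F `^ a * G `^ (1 - a) * a / F * x +
                           F `^ a * G `^ (1 - a) * (1 - a) / G * y.
Proof.
move=> a01 x0 y0 F0 G0.
have scale_powR (u H b : R) : 0 < u -> 0 < H -> H `^ b * (u / H) `^ b = u `^ b.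
  move=> u0 H0; rewrite -powRM ?divr_ge0 ?ltW//.
  by rewrite mulrC divfK// gt_eqF.
have C0 : 0 < F `^ a * G `^ (1 - a) by rewrite mulr_gt0 ?powR_gt0.
have := young_powR a01 (divr_gt0 x0 F0) (divr_gt0 y0 G0).
move=> /(ler_wpM2l (ltW C0)).
rewrite mulrACA !scale_powR// => /le_trans; apply.
by rewrite mulrDr !mulrA (mulrAC _ x) (mulrAC _ y).
Qed.

(** Hoelder's inequality: the scaled Young inequality is integrated with F and G the two integrals,
    so that its right-hand side integrates to F^a G^(1 - a) (a + (1 - a)). *)
Lemma Rintegral_log_convex d (T : measurableType d)
    (mu : {measure set T -> \bar R}) (D : set T) (f g h : T -> R) (a : R) :
  measurable D -> 0 <= a <= 1 ->
  mu.-integrable D (EFin \o f) -> mu.-integrable D (EFin \o g) ->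
  mu.-integrable D (EFin \o h) ->
  (forall t, D t -> 0 < f t) -> (forall t, D t -> 0 < g t) ->
  (forall t, D t -> h t = f t `^ a * g t `^ (1 - a)) ->
  0 < \int[mu]_(t in D) f t -> 0 < \int[mu]_(t in D) g t ->
  \int[mu]_(t in D) h t <=
  (\int[mu]_(t in D) f t) `^ a * (\int[mu]_(t in D) g t) `^ (1 - a).
Proof.
move=> mD a01 If Ig Ih f0 g0 hE.
set F := \int[mu]_(t in D) f t; set G := \int[mu]_(t in D) g t => F0 G0.
pose C := F `^ a * G `^ (1 - a).
pose k t := C * a / F * f t + C * (1 - a) / G * g t.
have Icf : mu.-integrable D (EFin \o (fun t => C * a / F * f t)).
  exact: (integrableZl mD _ If).
have Icg : mu.-integrable D (EFin \o (fun t => C * (1 - a) / G * g t)).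
  exact: (integrableZl mD _ Ig).
have Ik : mu.-integrable D (EFin \o k) by exact: (integrableD mD Icf Icg).
have -> : F `^ a * G `^ (1 - a) = \int[mu]_(t in D) k t.
  rewrite RintegralD// !RintegralZl// -/F -/G.
  by rewrite !divfK ?gt_eqF// -mulrDr [a + _]addrC subrK mulr1.
apply: le_Rintegral => // t Dt; rewrite hE// /k.
by apply: young_powR_scale => //; [exact: f0|exact: g0].
Qed.

End log_convexity.

(** * Integral representation of the Dunkl kernel *)

Section kernel_integral.
Context {R : realType}.
Notation mu := (@lebesgue_measure R).
Notation P := (`]0%R, +oo[%classic : set R).
Implicit Types (a b nu y v : R).

(** The old variable t = sqrt (v / (1 + v)) of the substitution. *)
Definition tau v : R := v `^ 2^-1 * (1 + v) `^ (- 2^-1).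

Definition beta_weight a b v : R := v `^ (a - 1) * (1 + v) `^ (- (a + b)).

(** The first factor is cosh (y t) + t sinh (y t) with t = [tau v]. The two parts stay separate
    because each yields one of the two Bessel series. *)
Definition dunkl_integrand nu y v : R :=
  ((expR (y * tau v) + expR (- (y * tau v))) / 2
   + (expR (y * tau v) - expR (- (y * tau v))) / 2 * tau v)
  * beta_weight 2^-1 nu v.

Lemma measurable_tau (D : set R) : measurable_fun D tau.
Proof. exact: measurable_Beta_integrand. Qed.

Lemma tau_gt0 v : 0 < v -> 0 < tau v.
Proof. by move=> v0; rewrite mulr_gt0 ?powR_gt0 ?addr_gt0. Qed.

Lemma tau_lt1 v : 0 < v -> tau v < 1.
Proof.
move=> v0; have v1 : 0 < 1 + v by rewrite addr_gt0.
rewrite /tau powRN -[ltRHS](@mulfV _ ((1 + v) `^ 2^-1)); last first.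
  by rewrite gt_eqF ?powR_gt0.
rewrite ltr_pM2r ?invr_gt0 ?powR_gt0//.
by apply: gt0_ltr_powR; rewrite ?nnegrE ?ltW ?ltrDr ?invr_gt0.
Qed.

Lemma beta_weight_gt0 a b v : 0 < v -> 0 < beta_weight a b v.
Proof. by move=> v0; rewrite mulr_gt0 ?powR_gt0 ?addr_gt0. Qed.

(** Even powers of [tau] only shift the first Beta parameter, which turns the termwise integrals
    into Beta integrals. *)
Lemma tau_beta_weight n a b v : 0 < v ->
  tau v ^+ (2 * n) * beta_weight a b v = beta_weight (n%:R + a) b v.
Proof.
move=> v0; have v1 : 0 < 1 + v by rewrite addr_gt0.
have e : 2^-1 * (2 * n)%:R = n%:R :> R by rewrite natrM mulKf ?pnatr_eq0.
rewrite /tau /beta_weight exprMn -!powR_mulrn ?powR_ge0// -!powRrM mulNr e.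
rewrite -[n%:R + a - 1]addrA -[n%:R + a + b]addrA [- (n%:R + _)]opprD.
rewrite [X in _ = X * _](@powRD _ _ n%:R); last by rewrite (gt_eqF v0) implybT.
rewrite [X in _ = _ * X](@powRD _ _ (- n%:R)); last by rewrite (gt_eqF v1) implybT.
by ring.
Qed.

Lemma integrable_beta_weight a b : 0 < a -> 0 < b ->
  mu.-integrable P (EFin \o beta_weight a b).
Proof.
move=> a0 b0; apply/integrableP; split.
  by apply/measurable_EFinP; exact: measurable_Beta_integrand.
rewrite [X in (X < _)%E](_ : _ = eBeta a b); first by rewrite eBetaE// ltry.
apply: eq_integral => v /[!inE]/= /[!in_itv]/= /[!andbT] v0.
by rewrite ger0_norm// ltW// beta_weight_gt0.
Qed.

Lemma Rintegral_beta_weight a b : 0 < a -> 0 < b ->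
  \int[mu]_(v in P) beta_weight a b v = Gamma a * Gamma b / Gamma (a + b).
Proof. by move=> a0 b0; rewrite /Rintegral -/(eBeta a b) eBetaE. Qed.

Lemma Rintegral_exp_coeff_even nu y n : 0 < nu ->
  \int[mu]_(v in P) (exp_coeff (y * tau v) (2 * n)%N * beta_weight 2^-1 nu v) =
  Gamma 2^-1 * Gamma nu *
  ((y / 2) ^+ (2 * n) / (n`!%:R * Gamma (n%:R + 2^-1 + nu))).
Proof.
move=> nu0; have h0 : 0 < n%:R + 2^-1 :> R by rewrite ltr_wpDl// invr_gt0.
have G0 : 0 < Gamma (n%:R + 2^-1 + nu) by apply: Gamma_gt0; exact: addr_gt0.
transitivity (\int[mu]_(v in P)
    (y ^+ (2 * n) / (2 * n)`!%:R * beta_weight (n%:R + 2^-1) nu v)).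
  apply: eq_Rintegral => v /[!inE]/= /[!in_itv]/= /[!andbT] v0.
  by rewrite -tau_beta_weight// /exp_coeff/= exprMn; ring.
rewrite RintegralZl//; last exact: integrable_beta_weight.
rewrite Rintegral_beta_weight// Gamma_half_nat expr_div_n [2 ^+ (2 * n)]exprM.
rewrite -[2 ^+ 2]natrX; move: (Gamma _) G0 (Gamma _) (Gamma _) => G G0 g1 g2.
by field; rewrite (gt_eqF G0) !pnatr_eq0 -!lt0n !fact_gt0 /= expf_neq0.
Qed.

(** The extra [tau] completes the odd power to 2n + 2, hence the index n + 1 in Gamma. The quotient
    (2n + 2)! / (2n + 1)! = 2 (n + 1) against 4 (n + 1) leaves the 1/2 of y / 2. *)
Lemma Rintegral_exp_coeff_odd nu y n : 0 < nu ->
  \int[mu]_(v in P)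
    (exp_coeff (y * tau v) (2 * n).+1%N * (tau v * beta_weight 2^-1 nu v)) =
  Gamma 2^-1 * Gamma nu * (y / 2) *
  ((y / 2) ^+ (2 * n) / (n`!%:R * Gamma (n.+1%:R + 2^-1 + nu))).
Proof.
move=> nu0; have h0 : 0 < n.+1%:R + 2^-1 :> R by rewrite addr_gt0// invr_gt0.
have G0 : 0 < Gamma (n.+1%:R + 2^-1 + nu) by apply: Gamma_gt0; exact: addr_gt0.
transitivity (\int[mu]_(v in P)
    (y ^+ (2 * n).+1 / (2 * n).+1`!%:R * beta_weight (n.+1%:R + 2^-1) nu v)).
  apply: eq_Rintegral => v /[!inE]/= /[!in_itv]/= /[!andbT] v0.
  rewrite -tau_beta_weight// /exp_coeff/= exprMn mulnS add2n [tau v ^+ (2 * n).+2]exprS.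
  by ring.
rewrite RintegralZl//; last exact: integrable_beta_weight.
rewrite Rintegral_beta_weight// Gamma_half_nat expr_div_n [2 ^+ (2 * n)]exprM.
rewrite -[2 ^+ 2]natrX; move: (Gamma _) G0 (Gamma _) (Gamma _) => G G0 g1 g2.
rewrite mulnS add2n !factS !natrM -!natr1 !exprS natrM.
field; rewrite (gt_eqF G0) !pnatr_eq0 -!lt0n !fact_gt0 /= expf_neq0//.
by rewrite -natrM !natr1 !pnatr_eq0.
Qed.

(** This grouping shows positivity: both exponentials have positive coefficients because 0 < tau <
    1, whereas the sign of the sinh part depends on y. *)
Lemma dunkl_integrandE nu y v :
  dunkl_integrand nu y v =
  ((1 + tau v) * expR (y * tau v) + (1 - tau v) * expR (- (y * tau v))) / 2
  * beta_weight 2^-1 nu v.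
Proof. by rewrite /dunkl_integrand; congr (_ * _); field. Qed.

Lemma dunkl_integrand_gt0 nu y v : 0 < v -> 0 < dunkl_integrand nu y v.
Proof.
move=> v0; rewrite dunkl_integrandE mulr_gt0 ?beta_weight_gt0//.
rewrite divr_gt0// addr_gt0// mulr_gt0 ?expR_gt0// ?subr_gt0 ?tau_lt1//.
by rewrite addr_gt0// tau_gt0.
Qed.

Let measurable_expR_tau y : measurable_fun P (fun v => expR (y * tau v)).
Proof.
apply: measurable_expR_comp; apply: measurable_funM => //.
exact: measurable_tau.
Qed.

Let measurable_even y :
  measurable_fun P (fun v => (expR (y * tau v) + expR (- (y * tau v))) / 2).
Proof.
apply: measurable_funM => //; apply: measurable_funD => //.
by apply: eq_measurable_fun (measurable_expR_tau (- y)) => v _; rewrite mulNr.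
Qed.

Let measurable_odd y :
  measurable_fun P (fun v => (expR (y * tau v) - expR (- (y * tau v))) / 2).
Proof.
apply: measurable_funM => //; apply: measurable_funB => //.
by apply: eq_measurable_fun (measurable_expR_tau (- y)) => v _; rewrite mulNr.
Qed.

Let measurable_exp_coeff_tau y n : measurable_fun P (fun v => exp_coeff (y * tau v) n).
Proof.
apply: measurable_funM => //; apply: measurable_funX; apply: measurable_funM => //.
exact: measurable_tau.
Qed.

(** Provides the constant [M], uniform in v, for termwise integration. *)
Let normr_ytau y v : P v -> expR `|y * tau v| <= expR `|y|.
Proof.
rewrite /= in_itv/= andbT => v0; rewrite ler_expR normrM ler_piMr//.
by rewrite gtr0_norm ?tau_gt0// ltW// tau_lt1.
Qed.

Let integrable_weight nu : 0 < nu ->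
  mu.-integrable P (EFin \o beta_weight 2^-1 nu).
Proof. by move=> nu0; apply: integrable_beta_weight; rewrite ?invr_gt0. Qed.

Let integrable_tau_weight nu : 0 < nu ->
  mu.-integrable P (EFin \o (fun v => tau v * beta_weight 2^-1 nu v)).
Proof.
move=> nu0; apply: (le_integrable _ _ _ (integrable_weight nu0)) => //.
  apply/measurable_EFinP; apply: measurable_funM; first exact: measurable_tau.
  exact: measurable_Beta_integrand.
move=> v /=; rewrite in_itv/= andbT => v0; rewrite lee_fin normrM ler_piMl//.
by rewrite gtr0_norm ?tau_gt0// ltW// tau_lt1.
Qed.

Let weight_ge0 nu v : P v -> 0 <= beta_weight 2^-1 nu v.
Proof. by rewrite /= in_itv/= andbT => v0; rewrite ltW// beta_weight_gt0. Qed.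

Let tau_weight_ge0 nu v : P v -> 0 <= tau v * beta_weight 2^-1 nu v.
Proof.
rewrite /= in_itv/= andbT => v0.
by apply/ltW/mulr_gt0; [exact: tau_gt0|exact: beta_weight_gt0].
Qed.

Let even_bound y v N : P v ->
  `|series (fun n => exp_coeff (y * tau v) (2 * n)%N) N| <= expR `|y|.
Proof.
by move=> Pv; exact: le_trans (normr_even_exp_coeff _ _) (normr_ytau _ Pv).
Qed.

Let odd_bound y v N : P v ->
  `|series (fun n => exp_coeff (y * tau v) (2 * n).+1%N) N| <= expR `|y|.
Proof.
by move=> Pv; exact: le_trans (normr_odd_exp_coeff _ _) (normr_ytau _ Pv).
Qed.

Let even_integrable nu y : 0 < nu -> mu.-integrable P (EFin \o (fun v =>
  (expR (y * tau v) + expR (- (y * tau v))) / 2 * beta_weight 2^-1 nu v)).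
Proof.
move=> nu0; apply: (@dominated_series_integrable _ _ _ mu P _
  (fun n v => exp_coeff (y * tau v) (2 * n)%N) _ _ (expR `|y|)) => //.
- exact: measurable_even.
- exact: integrable_weight.
- by move=> v N; exact: even_bound.
- by move=> v _; exact: cvg_even_exp_coeff.
Qed.

Let even_cvg nu y : 0 < nu ->
  series (fun n => \int[mu]_(v in P)
    (exp_coeff (y * tau v) (2 * n)%N * beta_weight 2^-1 nu v)) @ \oo -->
  \int[mu]_(v in P)
    ((expR (y * tau v) + expR (- (y * tau v))) / 2 * beta_weight 2^-1 nu v).
Proof.
move=> nu0; apply: (@dominated_series_cvg _ _ _ mu P _
  (fun n v => exp_coeff (y * tau v) (2 * n)%N) _ _ (expR `|y|)) => //.
- by move=> n; exact: measurable_exp_coeff_tau.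
- exact: measurable_even.
- exact: integrable_weight.
- by move=> v; exact: weight_ge0.
- by move=> v N; exact: even_bound.
- by move=> v _; exact: cvg_even_exp_coeff.
Qed.

Let odd_integrable nu y : 0 < nu -> mu.-integrable P (EFin \o (fun v =>
  (expR (y * tau v) - expR (- (y * tau v))) / 2 *
    (tau v * beta_weight 2^-1 nu v))).
Proof.
move=> nu0; apply: (@dominated_series_integrable _ _ _ mu P _
  (fun n v => exp_coeff (y * tau v) (2 * n).+1%N) _ _ (expR `|y|)) => //.
- exact: measurable_odd.
- exact: integrable_tau_weight.
- by move=> v N; exact: odd_bound.
- by move=> v _; exact: cvg_odd_exp_coeff.
Qed.

Let odd_cvg nu y : 0 < nu ->
  series (fun n => \int[mu]_(v in P) (exp_coeff (y * tau v) (2 * n).+1%N *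
    (tau v * beta_weight 2^-1 nu v))) @ \oo -->
  \int[mu]_(v in P) ((expR (y * tau v) - expR (- (y * tau v))) / 2 *
    (tau v * beta_weight 2^-1 nu v)).
Proof.
move=> nu0; apply: (@dominated_series_cvg _ _ _ mu P _
  (fun n v => exp_coeff (y * tau v) (2 * n).+1%N) _ _ (expR `|y|)) => //.
- by move=> n; exact: measurable_exp_coeff_tau.
- exact: measurable_odd.
- exact: integrable_tau_weight.
- by move=> v; exact: tau_weight_ge0.
- by move=> v N; exact: odd_bound.
- by move=> v _; exact: cvg_odd_exp_coeff.
Qed.

Lemma integrable_dunkl_integrand nu y : 0 < nu ->
  mu.-integrable P (EFin \o dunkl_integrand nu y).
Proof.
move=> nu0; have := integrableD _ (even_integrable y nu0) (odd_integrable y nu0).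
move=> /(_ (measurable_itv _)); congr (_.-integrable _ _).
apply/funext => v /=; rewrite /dunkl_integrand -EFinD; congr EFin.
by rewrite mulrA -mulrDl.
Qed.

(** The termwise integrals of the even and odd parts are exactly the terms of the two series in
    [dunkl_kernel_series]. *)
Lemma normalized_dunkl_kernelE nu lam x : 0 < nu ->
  normalized_dunkl_kernel nu lam x =
  \int[mu]_(v in P) dunkl_integrand nu (lam * x) v.
Proof.
move=> nu0; set y := lam * x.
have := @odd_cvg nu y nu0; have := @even_cvg nu y nu0.
under [X in series X]eq_fun do rewrite Rintegral_exp_coeff_even//.
move=> HS; under [X in series X]eq_fun do rewrite Rintegral_exp_coeff_odd//.
move=> /(dunkl_kernel_series nu0 HS) ->.
rewrite -RintegralD//; [|exact: even_integrable|exact: odd_integrable].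
by apply: eq_Rintegral => v _; rewrite mulrA -mulrDl.
Qed.

Lemma dunkl_integrand_log_affine s t a y v : 0 < v ->
  dunkl_integrand (a * s + (1 - a) * t) y v =
  dunkl_integrand s y v `^ a * dunkl_integrand t y v `^ (1 - a).
Proof.
move=> v0; have v1 : 0 < 1 + v by rewrite addr_gt0.
(* The parameter enters only through (1 + v)^(- nu); the value at 0 serves as the remaining factor,
   pointwise and without being integrated. *)
have split_ nu : dunkl_integrand nu y v =
    dunkl_integrand 0 y v * (1 + v) `^ (- nu).
  rewrite /dunkl_integrand /beta_weight addr0 opprD.
  by rewrite (@powRD _ _ (- 2^-1)) ?(gt_eqF v1) ?implybT// !mulrA.
have C0 := dunkl_integrand_gt0 0 y v0.
rewrite (split_ s) (split_ t) (split_ (_ + _)); clear split_.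
move: (dunkl_integrand 0 y v) C0 => c C0.
rewrite !(@powRM _ c) ?powR_ge0 ?(ltW C0)//.
rewrite mulrACA -[X in _ = X * _]powRD; last by rewrite (gt_eqF C0) implybT.
rewrite -!powRrM -[X in _ = _ * X]powRD; last by rewrite (gt_eqF v1) implybT.
rewrite (_ : a + (1 - a) = 1); last by ring.
by rewrite powRr1 ?(ltW C0)//; congr (_ * _ `^ _); ring.
Qed.

End kernel_integral.

(** * Log-convexity in the order and the resulting Turan-type inequality *)

Theorem theorem2 (R : realType) (lam x : R) :
  log_convex_on `]0, +oo[ (fun nu => normalized_dunkl_kernel nu lam x) /\
  (forall nu : R, 0 < nu ->
     normalized_dunkl_kernel (nu + 1) lam x ^+ 2 <=
     normalized_dunkl_kernel nu lam x * normalized_dunkl_kernel (nu + 2) lam x).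
Proof.
have pos nu : 0 < nu -> 0 < normalized_dunkl_kernel nu lam x.
  move=> nu0; rewrite normalized_dunkl_kernelE// -lte_fin fineK; last first.
    exact: integrable_fin_num (integrable_dunkl_integrand _ nu0).
  apply: gt0_integral_half_line.
    by have /measurable_EFinP :=
      measurable_int _ (integrable_dunkl_integrand (lam * x) nu0).
  by move=> v /=; rewrite in_itv/= andbT; exact: dunkl_integrand_gt0.
have lc s t a : 0 < s -> 0 < t -> 0 <= a <= 1 ->
    normalized_dunkl_kernel (a * s + (1 - a) * t) lam x <=
    normalized_dunkl_kernel s lam x `^ a *
    normalized_dunkl_kernel t lam x `^ (1 - a).
  move=> s0 t0 a01; have /andP[a0 a1] := a01.
  have st0 : 0 < a * s + (1 - a) * t.
    (* For a = 0 only the [t] term is positive; otherwise a s > 0 and the [t] term is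
       nonnegative. *)
    have [->|an0] := eqVneq a 0; first by rewrite mul0r add0r subr0 mul1r.
    have a_gt0 : 0 < a by rewrite lt0r an0.
    apply: ltr_pwDl; first exact: mulr_gt0.
    by apply: mulr_ge0; [rewrite subr_ge0|exact: ltW].
  have := pos _ s0; have := pos _ t0; rewrite !normalized_dunkl_kernelE// => It Is.
  apply: Rintegral_log_convex => //; try exact: integrable_dunkl_integrand.
  - by move=> v /=; rewrite in_itv/= andbT; exact: dunkl_integrand_gt0.
  - by move=> v /=; rewrite in_itv/= andbT; exact: dunkl_integrand_gt0.
  move=> v /=; rewrite in_itv/= andbT => v0.
  exact: dunkl_integrand_log_affine.
split; first split.
- by move=> s /=; rewrite in_itv/= andbT; exact: pos.
- move=> s t a /=; rewrite !in_itv/= !andbT; exact: lc.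
move=> nu nu0; have nu2 : 0 < nu + 2 by rewrite addr_gt0.
(* Since nu + 1 is the midpoint of nu and nu + 2, the weight 1/2 gives the square root of the
   claim. *)
have h : 0 <= (2^-1 : R) <= 1 by lra.
have p1 : 0 < normalized_dunkl_kernel (nu + 1) lam x by apply/pos/addr_gt0.
have p0 := pos _ nu0; have p2 := pos _ nu2.
have := lc _ _ _ nu0 nu2 h.
rewrite (_ : 2^-1 * nu + (1 - 2^-1) * (nu + 2) = nu + 1); last by field.
rewrite (_ : 1 - 2^-1 = 2^-1 :> R); last by field.
move: (normalized_dunkl_kernel (nu + 1) lam x) p1 => f1 p1.
move: (normalized_dunkl_kernel nu lam x) p0 => f0 p0.
move: (normalized_dunkl_kernel (nu + 2) lam x) p2 => f2 p2.
have f02 : 0 <= f0 * f2 by rewrite mulr_ge0// ltW.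
rewrite -powRM ?(ltW p0) ?(ltW p2)// powR12_sqrt// => f1_le.
by rewrite -[leRHS]sqr_sqrtr// ler_pXn2r// nnegrE ?sqrtr_ge0// ltW.
Qed.
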